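(* Let $\circledast,\odot$ be proper multiplications on $\mathbb{Z}^d$. The classes $\mathcal{PS}^*(\circledast)$ and $\mathcal{PS}^*(\odot)$ of subsets of $\mathbb{Z}^d_{\neq 0}$ are equal if and only if there exist $v,w\in\mathbb{Z}^d_{\neq 0}$ such that for all $x,y\in\mathbb{Z}^d_{\neq 0}$, \[x\circledast v\circledast y = x\odot w\odot y.\]
   Context: A proper multiplication on $\mathbb{Z}^d$ is a binary operation $\circledast:\mathbb{Z}^d\times\mathbb{Z}^d\to\mathbb{Z}^d$ that makes the abelian group $(\mathbb{Z}^d,+)$ into an associative (not necessarily commutative or unital) ring $(\mathbb{Z}^d,+,\circledast)$ without zero divisors. Write $\mathbb{Z}^d_{\neq 0}=\mathbb{Z}^d\setminus\{0\}$; then $(\mathbb{Z}^d_{\neq 0},\circledast)$ is a semigroup. For a semigroup $(S,\cdot)$, $s\in S$ and $A\subseteq S$, let $s^{-1}\cdot A=\{t\in S: s\cdot t\in A\}$. A set $A\subseteq S$ is thick if for every finite $F\subseteq S$ there is $x\in S$ with $F\cdot x\subseteq A$; it is piecewise syndetic if there are $s_1,\dots,s_k\in S$ such that $s_1^{-1}\cdot A\cup\dots\cup s_k^{-1}\cdot A$ is thick. $\mathcal{PS}^*(\circledast)$ denotes the class of subsets of $\mathbb{Z}^d_{\neq 0}$ which have non-empty intersection with every piecewise syndetic subset of the semigroup $(\mathbb{Z}^d_{\neq 0},\circledast)$. *)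

(* Defs.v *)
From mathcomp Require Export all_boot all_order all_algebra.
From mathcomp Require Export boolp classical_sets functions cardinality.

Set Implicit Arguments.
Unset Strict Implicit.
Unset Printing Implicit Defensive.

Import GRing.Theory.
Local Open Scope ring_scope.
Local Open Scope classical_set_scope.

Record proper_mul (d : nat)
    (mul : 'rV[int]_d -> 'rV[int]_d -> 'rV[int]_d) : Prop := ProperMul {
  proper_mulA : associative mul;
  proper_mulDl : left_distributive mul +%R;
  proper_mulDr : right_distributive mul +%R;
  proper_mul_eq0 : forall x y, mul x y = 0 -> x = 0 \/ y = 0 }.

Definition nonzero_vecs (d : nat) : set 'rV[int]_d := [set x | x <> 0].

(* A semigroup is given by a carrier [S : set T] and an operation [op] on the
   ambient type [T], meant to be associative on [S] and to preserve [S]. *)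
Section Semigroup.
Variables (T : Type) (S : set T) (op : T -> T -> T).

Definition left_quotient (s : T) (A : set T) : set T :=
  [set t | S t /\ A (op s t)].

Definition thick (A : set T) : Prop :=
  forall F : set T, finite_set F -> F `<=` S ->
    exists2 x, S x & [set op f x | f in F] `<=` A.

Definition piecewise_syndetic (A : set T) : Prop :=
  exists (k : nat) (s : 'I_k -> T),
    (forall i, S (s i)) /\ thick (\bigcup_i left_quotient (s i) A).

Definition PSstar : set (set T) :=
  [set A | A `<=` S /\
    forall B, B `<=` S -> piecewise_syndetic B -> A `&` B !=set0].

End Semigroup.

(* Main.v *)
(* Over the rationals, a proper multiplication turns Q^d into a division
   algebra, which is encoded by the space of its left multiplications.  Write
   [L] and [L'] for the left multiplications of [m] and [o]; here operators act
   on the left, whereas matrices act below on row vectors from the right, so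
   that products are reversed.  The condition on [v] and [w] holds if and only
   if [L] and [L'] have the same image.

   If it holds, the identity transports a witness of piecewise syndeticity from
   [m] to [o].  Conversely, let [F_n] be finite sets increasing to the set of
   all nonzero vectors, and let [A] be the union of the layers [m F_n x_n]; it
   is thick for [m], whatever the [x_n] are.  An equation [o b y = m p x]
   amounts to [y = L'(b)^-1 L(p) x].  Each [x_n] is chosen outside finitely many
   proper affine subspaces, so that [L'(b)^-1 L(p) x_k = L'(c)^-1 L(q) x_n] is
   only possible when [L'(b)^-1 L(p) = L'(c)^-1 L(q)]; such an [x_n] exists on
   the curve [n -> (n, n^2, ..., n^d)], where an affine condition becomes a
   polynomial equation.  If [A] is piecewise syndetic for [o], the nonzero
   vectors [f] are then covered by the finitely many subspaces of the [f] such
   that [L'(s_i) L'(f) L'(o s_j g)^-1] is in the image of [L].  One of these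
   subspaces is the whole of Q^d, and this forces the image of [L'] into that
   of [L]. *)

From HB Require Import structures.
From mathcomp Require Import finmap.
Require Import Defs.

Set Implicit Arguments.
Unset Strict Implicit.
Unset Printing Implicit Defensive.

Import GRing.Theory Num.Theory.

Local Open Scope ring_scope.
Local Open Scope classical_set_scope.

Section PiecewiseSyndetic.
Variables (T : Type) (S : set T).
Implicit Types (op : T -> T -> T) (A B : set T).

Lemma piecewise_syndetic_sub op A B :
  A `<=` B -> piecewise_syndetic S op A -> piecewise_syndetic S op B.
Proof.
move=> sAB [k [s [Ss thickA]]]; exists k, s; split=> // F finF sFS.
have [x Sx FxA] := thickA F finF sFS; exists x => // z /FxA[i _ [Sz Asz]].
by exists i => //; split=> //; apply: sAB.
Qed.

Lemma PSstar_eqP op1 op2 :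
  PSstar S op1 = PSstar S op2 <->
  forall A, A `<=` S ->
    piecewise_syndetic S op1 A <-> piecewise_syndetic S op2 A.
Proof.
split=> [eqPS|eqPS]; last first.
  by apply/seteqP; split=> A [sAS meetA]; split=> // B sBS /(eqPS B sBS);
    apply: meetA.
suff sub op op' : PSstar S op = PSstar S op' -> forall A, A `<=` S ->
    piecewise_syndetic S op A -> piecewise_syndetic S op' A.
  by move=> A sAS; split; apply: sub.
move=> {}eqPS A sAS psA; apply: contrapT => npsA.
have : PSstar S op' (S `\` A).
  split=> [x []//|B sBS psB]; apply: contrapT => disj; apply: npsA.
  apply: piecewise_syndetic_sub psB => x Bx; apply: contrapT => nAx.
  by apply: disj; exists x; do !split=> //; apply: sBS.
by rewrite -eqPS => -[_ /(_ A sAS psA)[x [[]]]].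
Qed.

(* The isotopy turns the [op1]-product [s v f v x] into the [op2]-product
   [s w f w x]. *)
Lemma piecewise_syndetic_isotopic op1 op2 v w A :
    associative op1 -> (forall x y, S x -> S y -> S (op1 x y)) ->
    associative op2 -> (forall x y, S x -> S y -> S (op2 x y)) ->
    S v -> S w ->
    (forall x y, S x -> S y -> op1 (op1 x v) y = op2 (op2 x w) y) ->
  piecewise_syndetic S op1 A -> piecewise_syndetic S op2 A.
Proof.
move=> op1A op1S op2A op2S Sv Sw isotopy [k [s [Ss thickA]]].
exists k, (fun i => op2 (s i) w); split=> [i|F finF sFS]; first exact: op2S.
have [||x Sx FxA] := thickA [set op1 (op1 v f) v | f in F].
- exact: finite_image.
- by move=> _ [f /sFS Sf <-]; do !apply/op1S.
exists (op2 w x) => [|_ [f Ff <-]]; first exact: op2S.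
have Sf := sFS f Ff.
have [|i _ [_ Ai]] := FxA (op1 (op1 (op1 v f) v) x).
  by exists (op1 (op1 v f) v) => //; exists f.
exists i => //; split; first by do !apply/op2S.
suff <- : op1 (s i) (op1 (op1 (op1 v f) v) x) =
          op2 (op2 (s i) w) (op2 f (op2 w x)) by [].
rewrite !op1A !op2A -(isotopy (s i)) // -isotopy //.
by do !apply/op1S.
Qed.

Lemma thick_piecewise_syndetic op A :
    associative op -> (forall x y, S x -> S y -> S (op x y)) -> S !=set0 ->
  thick S op A -> piecewise_syndetic S op A.
Proof.
move=> opA opS [s Ss] thickA; exists 1%N, (fun=> s); split=> // F finF sFS.
have [||x Sx FxA] := thickA (op s @` F).
- exact: finite_image.
- by move=> _ [f /sFS Sf <-]; apply: opS.
exists x => // _ [f Ff <-]; exists ord0 => //; split.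
  by apply: opS => //; apply: sFS.
by rewrite opA; apply: FxA; exists (op s f) => //; exists f.
Qed.

End PiecewiseSyndetic.

Section CancellativeSemigroup.
Variables (T : choiceType) (S : set T) (op : T -> T -> T).
Hypotheses (opA : associative op) (opS : forall x y, S x -> S y -> S (op x y)).
Hypothesis infinite_S : infinite_set S.

Hypothesis oprI : forall x, S x -> injective (op x).
Hypothesis opIr : forall x, S x -> injective (op^~ x).

(* Thickness is applied to the products of [F] with more than [#|G|] elements
   [z] of [S]: some [y = op z x] is then not in [G]. *)
Lemma thick_avoid (A F G : set T) :
    thick S op A -> finite_set F -> F `<=` S -> finite_set G ->
  exists y, [/\ S y, ~ G y & [set op f y | f in F] `<=` A].
Proof.
move=> thickA finF sFS /finite_seqP[g ->].
have [Z sZS ltgZ] := infinite_set_fset (size g).+1 infinite_S.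
have [||x Sx FZxA] := thickA [set op f z | f in F & z in [set` Z]].
- exact: finite_image2.
- by move=> _ [f Ff [z Zz <-]]; apply: opS; [apply: sFS | apply: sZS].
have [z Zz gN] : exists2 z, z \in Z & op z x \notin g.
  apply/hasP; rewrite has_predC; apply/negP => /allP allg.
  have : (size [seq op z x | z <- Z] <= size g)%N.
    apply: uniq_leq_size => [|_ /mapP[z Zz ->]]; last exact: allg.
    by rewrite map_inj_uniq ?fset_uniq //; apply: opIr.
  by rewrite size_map leqNgt ltgZ.
exists (op z x); split=> [||_ [f Ff <-]]; last 1 first.
- by rewrite opA; apply: FZxA; exists (op f z) => //; exists f => //; exists z.
- by apply: opS => //; apply: sZS.
- exact/negP.
Qed.

Lemma piecewise_syndetic_bigcup_tail (A : nat -> set T) :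
    (forall n, finite_set (A n)) ->
    piecewise_syndetic S op (\bigcup_n A n) ->
  exists k (s : 'I_k -> T), (forall i, S (s i)) /\
    forall (F : set T) N, finite_set F -> F `<=` S -> exists2 y, S y &
      forall f, F f -> exists i n, (N <= n)%N /\ A n (op (op (s i) f) y).
Proof.
move=> finA [k [s [Ss thickA]]]; exists k, s; split=> // F N finF sFS.
pose early := \bigcup_(i in [set: 'I_k]) \bigcup_(f in F) \bigcup_(n in `I_N)
  (op (op (s i) f) @^-1` A n).
have [|y [Sy late FyA]] := thick_avoid thickA finF sFS (G := early).
  do 2![apply: bigcup_finite => // *]; apply: bigcup_finite => // n _.
  apply: finite_preimage => // ? ? _ _; apply: oprI.
  by apply: opS => //; apply: sFS.
exists y => // f Ff.
have [|i _ [_ [n _ Any]]] := FyA (op f y); first by exists f.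
exists i, n; rewrite -opA; split=> //; rewrite leqNgt; apply/negP => ltnN.
by apply: late; exists i => //; exists f => //; exists n; rewrite //= -opA.
Qed.

End CancellativeSemigroup.

Lemma history_choice T (P : seq T -> T -> Prop) :
  (forall xs, exists x, P xs x) ->
  exists x : nat -> T, forall n, P (mkseq x n) (x n).
Proof.
move=> /choice[next nextP].
pose history := fix history n :=
  if n is n'.+1 then rcons (history n') (next (history n')) else [::].
exists (next \o history) => n.
suff -> : mkseq (next \o history) n = history n by apply: nextP.
by elim: n => // n IHn; rewrite mkseqS IHn.
Qed.

Section InitialSeq.
Variables (T : countType) (P : pred T).

Definition initial_seq n : seq T :=
  [seq x <- pmap pickle_inv (iota 0 n) | P x].

Lemma mem_initial_seq n x : (x \in initial_seq n) = P x && (pickle x < n)%N.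
Proof.
rewrite mem_filter; congr (_ && _); rewrite mem_pmap.
apply/mapP/idP => [[i + eq_x]|ltxn].
  rewrite mem_iota add0n /=.
  by have := @pickle_invK T i; rewrite -eq_x /= => ->.
by exists (pickle x); rewrite ?mem_iota ?pickleK_inv.
Qed.

Lemma finite_sub_initial_seq (F : set T) :
  finite_set F -> F `<=` P -> exists n, F `<=` [set` initial_seq n].
Proof.
move=> /finite_seqP[s ->] sP; exists (\max_(x <- s) (pickle x).+1)%N => x sx /=.
rewrite mem_initial_seq sP //=.
exact: (@leq_bigmax_seq _ _ xpredT (fun x => (pickle x).+1)).
Qed.

End InitialSeq.

Lemma unitmx_neq0 (F : fieldType) d (A : 'M[F]_d) :
  (0 < d)%N -> A \in unitmx -> A != 0.
Proof.
move=> d_gt0; apply: contraTneq => ->.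
by rewrite -row_free_unit /row_free mxrank0 eq_sym -lt0n.
Qed.

Section GenericIntegerVectors.
Variable R : numDomainType.

Lemma ex_nonroot_nat (p : {poly R}) : p != 0 -> exists n, ~~ root p n%:R.
Proof.
move=> p0; apply: contrapT => /forallNP roots_p.
have /(max_poly_roots p0) : all (root p) [seq n%:R | n <- iota 0 (size p)].
  by apply/allP => _ /mapP[n _ ->]; apply/negPn/negP/roots_p.
rewrite size_map size_iota ltnn => not_uniq.
suff /not_uniq : uniq [seq n%:R : R | n <- iota 0 (size p)] by [].
by rewrite map_inj_uniq ?iota_uniq //; apply: mulrIn (oner_neq0 _).
Qed.

(* The exponents start at [1], so that the constant term of an affine equation
   cannot cancel a coefficient of its linear part. *)
Definition moment_row d (n : nat) : 'rV[int]_d := \row_i (n%:Z ^+ i.+1).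

Lemma moment_row_affine_root d q (A : 'M[R]_(d, q)) b : A != 0 ->
  exists2 p : {poly R}, p != 0 &
    forall n, map_mx intr (moment_row d n) *m A = b -> root p n%:R.
Proof.
move=> /matrix0Pn[i [j Aij]].
pose p := \sum_k A k j *: 'X^(k.+1) - (b 0 j)%:P.
exists p => [|n /rowP/(_ j) eqb].
  apply: contraNneq Aij => /(congr1 (fun p : {poly R} => p`_i.+1)).
  rewrite coefB coefC coef0 subr0 coef_sum (bigD1 i) //= big1 => [|k neq_ki].
    by rewrite addr0 coefZ coefXn eqxx mulr1 => ->.
  by rewrite coefZ coefXn eqSS val_eqE eq_sym (negPf neq_ki) mulr0.
rewrite rootE !hornerE horner_sum -eqb mxE subr_eq0; apply/eqP.
apply: eq_bigr => k _.
by rewrite !hornerE !mxE mulrC rmorphXn.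
Qed.

Lemma generic_rVint d q (r : seq ('M[R]_(d, q) * 'rV[R]_q)) :
  exists x : 'rV[int]_d, forall A b, (A, b) \in r -> A != 0 ->
    map_mx intr x *m A <> b.
Proof.
have /choice[p pP] (Ab : 'M[R]_(d, q) * 'rV[R]_q) : exists p : {poly R},
    p != 0 /\ (Ab.1 != 0 -> forall n,
      map_mx intr (moment_row d n) *m Ab.1 = Ab.2 -> root p n%:R).
  have [->|A0] := eqVneq Ab.1 0; first by exists 1; rewrite oner_neq0.
  by have [p p0 rootp] := moment_row_affine_root Ab.2 A0; exists p.
have [|n] := @ex_nonroot_nat (\prod_(Ab <- r) p Ab).
  by rewrite prodf_seq_neq0; apply/allP => Ab _; have [] := pP Ab.
rewrite rootE horner_prod prodf_seq_neq0 => /allP nonroot.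
exists (moment_row d n) => A b rAb A0.
by have [_ /(_ A0 n)rootp] := pP (A, b); move=> /rootp; apply/negP/nonroot.
Qed.

End GenericIntegerVectors.

Section SeparatingSequence.
Variable F : numFieldType.

Lemma finite_cover_submx (I : finType) d q r (G : I -> 'M[F]_(d, q))
    (U : 'M[F]_(r, q)) :
  (forall x : 'rV[int]_d, exists i, (map_mx intr x *m G i <= U)%MS) ->
  exists i, (G i <= U)%MS.
Proof.
move=> coverU; apply: contrapT => /forallNP GU.
have [x xU] := generic_rVint [seq (G i *m cokermx U, 0) | i <- enum I].
have [i] := coverU x; rewrite submxE -mulmxA; apply/negP/eqP.
by apply: xU; [apply: map_f; rewrite mem_enum | rewrite -submxE; apply/negP/GU].
Qed.

Variable d : nat.
Hypothesis d_gt0 : (0 < d)%N.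
Implicit Types (A B : 'M[F]_d) (x y : 'rV[int]_d).

Local Notation "x ^F" := (map_mx (intr : int -> F) x)
  (at level 2, format "x ^F").

Definition separated (Ms : seq 'M[F]_d) (ys : seq 'rV[int]_d) x : Prop :=
  [/\ x <> 0, {in Ms &, injective (mulmx x^F)}
    & {in ys, forall y, {in Ms &, forall A B, x^F *m A <> y^F *m B}}].

Lemma ex_separated Ms ys : 0 \notin Ms -> exists x, separated Ms ys x.
Proof.
move=> Ms_neq0.
pose kernels := [seq (A - B, 0 : 'rV[F]_d) | A <- Ms, B <- Ms].
pose collisions :=
  [seq (A, b) | A <- Ms, b <- [seq y^F *m B | y <- ys, B <- Ms]].
have [x xP] := generic_rVint ((1%:M, 0) :: kernels ++ collisions).
exists x; split=> [x0|A B MsA MsB eqAB|y ys_y A B MsA MsB].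
- have : x^F *m 1%:M <> 0; last by rewrite x0 map_mx0 mul0mx.
  apply: xP; first exact: mem_head.
  exact: unitmx_neq0 d_gt0 (unitmx1 _ _).
- apply/eqP; rewrite -subr_eq0; apply: contrapT => /negP neqAB.
  have : x^F *m (A - B) <> 0; last by rewrite mulmxBr eqAB subrr.
  apply: xP neqAB; rewrite inE mem_cat; apply/or3P/Or32.
  by apply/allpairsP; exists (A, B).
- apply: xP; last by apply: contraNneq Ms_neq0 => <-.
  rewrite inE mem_cat; apply/or3P/Or33/allpairsP.
  exists (A, y^F *m B); split=> //.
  by apply/allpairsP; exists (y, B).
Qed.

Lemma separating_sequence (M : nat -> seq 'M[F]_d) :
    {homo M : k n / (k <= n)%N >-> {subset k <= n}} ->
    (forall n, 0 \notin M n) ->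
  exists2 x : nat -> 'rV[int]_d, forall n, x n <> 0 &
    forall k n A B, A \in M k -> B \in M n ->
      (x k)^F *m A = (x n)^F *m B -> A = B.
Proof.
move=> M_mono M_neq0.
have [ys|x xP] := history_choice (P := fun ys => separated (M (size ys)) ys).
  exact: ex_separated.
have {}xP n : separated (M n) (mkseq x n) (x n).
  by have := xP n; rewrite size_mkseq.
exists x => [n|k n A B MA MB eqAB]; first by have [] := xP n.
have mem_x i j : (i < j)%N -> x i \in mkseq x j.
  by move=> ltij; apply: map_f; rewrite mem_iota.
case: (ltngtP k n) => [ltkn|ltnk|eqkn].
- have [_ _ /(_ _ (mem_x _ _ ltkn) B A MB)[]//] := xP n.
  exact: M_mono (ltnW ltkn) _ MA.
- have [_ _ /(_ _ (mem_x _ _ ltnk) A B MA)[]//] := xP k.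
  exact: M_mono (ltnW ltnk) _ MB.
- by rewrite -eqkn in MB eqAB; have [_ inj_x _] := xP k; apply: inj_x.
Qed.

End SeparatingSequence.

Section DivisionTable.
Variables (F : fieldType) (d : nat).
Implicit Types (R : 'M[F]_(d, d * d)) (x y : 'rV[F]_d) (A B C : 'M[F]_d).

(* Row [i] of [R] is the matrix, acting on row vectors from the right, of the
   left multiplication by the [i]-th basis vector: [y *m lmul_mx R x] is the
   product of [x] and [y]. *)
Definition lmul_mx R x : 'M[F]_d := vec_mx (x *m R).

HB.instance Definition _ R :=
  GRing.Linear.copy (lmul_mx R) (vec_mx \o mulmxr R).

Record division_table R : Prop := DivisionTable {
  lmul_mxM : forall x y,
    lmul_mx R (y *m lmul_mx R x) = lmul_mx R y *m lmul_mx R x;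
  lmul_mx_unit : forall x, x != 0 -> lmul_mx R x \in unitmx }.

Lemma lmul_mxP R A : reflect (exists x, A = lmul_mx R x) (A \in R)%MS.
Proof.
apply: (iffP submxP) => -[x defA]; exists x; last by rewrite defA vec_mxK.
by rewrite /lmul_mx -defA mxvecK.
Qed.

Lemma mem_lmul_mx R x : (lmul_mx R x \in R)%MS.
Proof. by apply/lmul_mxP; exists x. Qed.

Section Theory.
Variable R : 'M[F]_(d, d * d).
Hypothesis divR : division_table R.

Lemma lmul_mx_inj : injective (lmul_mx R).
Proof.
move=> x y eqL; apply/eqP; rewrite -subr_eq0; apply: contraT => xy0.
have Lu := lmul_mx_unit divR xy0; case/eqP: xy0; apply: (can_inj (mulmxK Lu)).
by rewrite linearB /= eqL subrr !mulmx0.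
Qed.

Lemma mem_division_tableM A B : (A \in R -> B \in R -> A *m B \in R)%MS.
Proof.
move=> /lmul_mxP[x ->] /lmul_mxP[y ->]; rewrite -(lmul_mxM divR).
exact: mem_lmul_mx.
Qed.

Hypothesis d_gt0 : (0 < d)%N.

Lemma lmul_mx_unitE x : (lmul_mx R x \in unitmx) = (x != 0).
Proof.
apply/idP/idP => [/(unitmx_neq0 d_gt0)|]; last exact: lmul_mx_unit.
by apply: contraNneq => ->; rewrite linear0.
Qed.

Lemma division_table_unit :
  exists2 e, lmul_mx R e = 1%:M & forall x, e *m lmul_mx R x = x.
Proof.
pose x : 'rV[F]_d := const_mx 1.
have x0 : x != 0.
  apply/eqP => /rowP/(_ (Ordinal d_gt0)).
  by rewrite !mxE; apply/eqP/oner_neq0.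
have Lx := lmul_mx_unit divR x0.
pose e := x *m invmx (lmul_mx R x).
have Le : lmul_mx R e = 1%:M.
  by rewrite -[LHS](mulmxK Lx) -(lmul_mxM divR) mulmxKV // mulmxV.
exists e => // y; apply: lmul_mx_inj.
by rewrite (lmul_mxM divR) Le mul1mx.
Qed.

Lemma mem_division_tableV A : (A \in R -> invmx A \in R)%MS.
Proof.
have [e Le _] := division_table_unit.
have [Au|/invmx_out -> //] := boolP (A \in unitmx).
move=> /lmul_mxP[x defA]; apply/lmul_mxP; exists (e *m invmx A).
apply: (can_inj (mulmxK Au)).
by rewrite mulVmx // {2}defA -(lmul_mxM divR) -defA mulmxKV.
Qed.

End Theory.

Variables R R' : 'M[F]_(d, d * d).
Hypothesis d_gt0 : (0 < d)%N.
Hypotheses (divR : division_table R) (divR' : division_table R').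

Lemma division_table_sub A B : A \in unitmx -> B \in unitmx ->
    (A \in R')%MS -> (B \in R')%MS ->
    (forall x, invmx A *m (lmul_mx R' x *m B) \in R)%MS ->
  (R' <= R)%MS.
Proof.
move=> Au Bu R'A R'B RAB.
have R_R' C : (C \in R' -> invmx A *m C \in R)%MS.
  move=> R'C; have := mem_division_tableM divR' R'C
    (mem_division_tableV divR' d_gt0 R'B).
  by move=> /lmul_mxP[x defx]; have := RAB x; rewrite -defx mulmxKV.
have RA : (A \in R)%MS.
  have [e Le _] := division_table_unit divR' d_gt0.
  rewrite -[A]invmxK; apply: mem_division_tableV => //.
  by rewrite -[invmx A]mulmx1 -Le; apply/R_R'/mem_lmul_mx.
apply/memmx_subP => C /R_R' RC; rewrite -(mulKVmx Au C).
exact: mem_division_tableM.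
Qed.

Lemma division_table_isotopy : (R' <= R)%MS -> exists v w, [/\ v != 0, w != 0 &
  forall x, lmul_mx R v *m lmul_mx R x = lmul_mx R' w *m lmul_mx R' x].
Proof.
move=> /memmx_subP sub.
have [e Le eK] := division_table_unit divR d_gt0.
have [e' Le' e'K] := division_table_unit divR' d_gt0.
have lmulE x : lmul_mx R' x = lmul_mx R (e *m lmul_mx R' x).
  have /lmul_mxP[y ->] := sub _ (mem_lmul_mx R' x).
  by rewrite eK.
have /lmul_mxP[w invE] : (invmx (lmul_mx R' e) \in R')%MS.
  exact/mem_division_tableV/mem_lmul_mx.
have e_neq0 : e != 0 by rewrite -(lmul_mx_unitE divR) // Le unitmx1.
have e_unit : lmul_mx R' e \in unitmx by apply: lmul_mx_unit divR' _ e_neq0.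
exists e, w; split=> // [|x].
  by rewrite -(lmul_mx_unitE divR') // -invE unitmx_inv.
rewrite Le mul1mx.
have ewE : e *m lmul_mx R' w = e'.
  by apply: (lmul_mx_inj divR'); rewrite (lmul_mxM divR') Le' -invE mulmxV.
by rewrite -(lmul_mxM divR') lmulE (lmul_mxM divR') mulmxA ewE e'K.
Qed.

End DivisionTable.

Lemma mul_rVint_lin1 d n (f : 'rV[int]_d -> 'rV[int]_n) x :
  zmod_morphism f -> x *m lin1_mx f = f x.
Proof.
move=> fB; pose g : {additive 'rV[int]_d -> 'rV[int]_n} :=
  HB.pack f (GRing.isZmodMorphism.Build _ _ f fB).
have gZ : scalable g by move=> a y; rewrite -[a]intz !scaler_int raddfMz.
pose h : {linear 'rV[int]_d -> 'rV[int]_n} :=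
  HB.pack f g (GRing.isScalable.Build _ _ _ _ f gZ).
exact: (mul_rV_lin1 h).
Qed.

Local Notation "x ^Q" := (map_mx (intr : int -> rat) x)
  (at level 2, format "x ^Q").

Lemma rVrat_intP d (x : 'rV[rat]_d) :
  exists2 a : rat, a != 0 & exists z, x = a *: z^Q.
Proof.
have [q [a a0 defx]] := rat_poly_scale (rVpoly x).
exists a%:~R^-1; rewrite ?invr_eq0 ?intr_eq0 //.
by exists (poly_rV q); rewrite map_poly_rV -[LHS]rVpolyK defx linearZ.
Qed.

Lemma rVint_ratI d : injective (fun x : 'rV[int]_d => x^Q).
Proof.
move=> x y /rowP eq_xy; apply/rowP => i; apply: (@intr_inj rat).
by have := eq_xy i; rewrite !mxE.
Qed.

Lemma infinite_nonzero_vecs d : (0 < d)%N -> infinite_set (@nonzero_vecs d).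
Proof.
move=> d_gt0 /finite_seqP[s eq_s].
have [x x_generic] := generic_rVint [seq (1%:M : 'M[rat]_d, v^Q) | v <- 0 :: s].
have x_neq v : v \in 0 :: s -> x <> v.
  move=> sv eq_xv; apply: (x_generic 1%:M v^Q); first exact: (map_f _ sv).
    exact: unitmx_neq0 d_gt0 (unitmx1 _ _).
  by rewrite eq_xv mulmx1.
have : [set` s] x by rewrite -eq_s; apply: x_neq; rewrite mem_head.
by move=> /= sx; apply: (x_neq x); rewrite // inE sx orbT.
Qed.

Definition mul_table d (m : 'rV[int]_d -> 'rV[int]_d -> 'rV[int]_d) :
    'M[rat]_(d, d * d) :=
  (lin1_mx (fun x => mxvec (lin1_mx (m x))))^Q.

Local Notation lmul m x := (lmul_mx (mul_table m) x^Q).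

Section ProperMultiplication.
Variables (d : nat) (m : 'rV[int]_d -> 'rV[int]_d -> 'rV[int]_d).
Hypothesis hm : proper_mul m.
Implicit Types x y : 'rV[int]_d.

Lemma proper_mulBr x : zmod_morphism (m x).
Proof.
by move=> y z; apply: (addIr (m x z)); rewrite -(proper_mulDr hm) !subrK.
Qed.

Lemma proper_mulBl y : zmod_morphism (m^~ y).
Proof.
by move=> x z /=; apply: (addIr (m z y)); rewrite -(proper_mulDl hm) !subrK.
Qed.

Lemma proper_mul_neq0 x y : x <> 0 -> y <> 0 -> m x y <> 0.
Proof. by move=> x0 y0 /(proper_mul_eq0 hm)[]. Qed.

Lemma proper_mulrI x : x <> 0 -> injective (m x).
Proof.
move=> x0 y z eq_m; apply/eqP; rewrite -subr_eq0; apply/eqP.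
have /(proper_mul_eq0 hm)[] // : m x (y - z) = 0.
by rewrite proper_mulBr eq_m subrr.
Qed.

Lemma proper_mulIr y : y <> 0 -> injective (m^~ y).
Proof.
move=> y0 x z /= eq_m; apply/eqP; rewrite -subr_eq0; apply/eqP.
have /(proper_mul_eq0 hm)[] // : m (x - z) y = 0.
by rewrite (proper_mulBl y) eq_m subrr.
Qed.

Lemma mul_tableE x y : (m x y)^Q = y^Q *m lmul m x.
Proof.
rewrite /lmul_mx -map_mxM -map_vec_mx -map_mxM mul_rVint_lin1 => [|a b].
  by rewrite mxvecK mul_rVint_lin1 //; apply: proper_mulBr.
rewrite -linearB; congr (mxvec _); apply/matrixP => i j; rewrite !mxE.
by rewrite (proper_mulBl (delta_mx 0 i)) !mxE.
Qed.

Lemma mul_tableM x y : lmul m (m x y) = lmul m y *m lmul m x.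
Proof.
apply/row_matrixP => i; rewrite !rowE -(map_delta_mx (intr : int -> rat)).
by rewrite mulmxA -!mul_tableE (proper_mulA hm).
Qed.

Lemma mul_table_division : division_table (mul_table m).
Proof.
split=> [x y|x].
  have [a _ [x' ->]] := rVrat_intP x; have [b _ [y' ->]] := rVrat_intP y.
  rewrite !(linearZ, =^~ scalemxAl) /= -!scalemxAl -mul_tableE.
  by rewrite mul_tableM !scalerA mulrC.
have [a a0 [x' ->]] := rVrat_intP x.
rewrite scaler_eq0 negb_or => /andP[_ x'0].
rewrite linearZ /= unitmxZ ?unitfE // -row_free_unit -kermx_eq0.
apply: contraT => /rowV0Pn[y /sub_kermxP yLx y0].
have [b b0 [y' defy]] := rVrat_intP y.
have mxy0 : m x' y' = 0.
  apply: rVint_ratI; rewrite mul_tableE map_mx0; apply: (scalerI b0).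
  by rewrite scalemxAl -defy yLx scaler0.
case: (proper_mul_eq0 hm mxy0) => [x'_eq0|y'_eq0].
  by rewrite x'_eq0 map_mx0 eqxx in x'0.
by rewrite defy y'_eq0 map_mx0 scaler0 eqxx in y0.
Qed.

Lemma mul_table_unit x : x <> 0 -> lmul m x \in unitmx.
Proof.
move=> x0; apply: lmul_mx_unit mul_table_division _ _.
by apply/eqP => xQ0; apply/x0/rVint_ratI; rewrite xQ0 map_mx0.
Qed.

End ProperMultiplication.

Section Layers.
Variables (d : nat) (m : 'rV[int]_d -> 'rV[int]_d -> 'rV[int]_d).
Hypothesis hm : proper_mul m.
Local Notation S := (@nonzero_vecs d).

Definition nonzero_seq n : seq 'rV[int]_d := initial_seq (fun x => x != 0) n.

Lemma nonzero_seq_neq0 n x : x \in nonzero_seq n -> x <> 0.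
Proof. by rewrite mem_initial_seq => /andP[/eqP]. Qed.

Lemma nonzero_seq_mono :
  {homo nonzero_seq : k n / (k <= n)%N >-> {subset k <= n}}.
Proof.
move=> n n' le_nn' x; rewrite !mem_initial_seq => /andP[-> /= lt_xn].
exact: leq_trans lt_xn le_nn'.
Qed.

Lemma finite_sub_nonzero_seq (F : set 'rV[int]_d) :
  finite_set F -> F `<=` S -> exists n, F `<=` [set` nonzero_seq n].
Proof. by move=> finF F0; apply: finite_sub_initial_seq => // x /F0/eqP. Qed.

Definition layer (x : nat -> 'rV[int]_d) n : set 'rV[int]_d :=
  [set m p (x n) | p in [set` nonzero_seq n]].

Lemma finite_layer x n : finite_set (layer x n).
Proof. exact/finite_image/finite_seq. Qed.

Lemma layers_neq0 x : (forall n, x n <> 0) -> \bigcup_n layer x n `<=` S.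
Proof.
by move=> x0 _ [n _ [p /nonzero_seq_neq0 p0 <-]]; apply: (proper_mul_neq0 hm).
Qed.

Lemma thick_layers x : (forall n, x n <> 0) -> thick S m (\bigcup_n layer x n).
Proof.
move=> x0 F finF F0; have [n Fn] := finite_sub_nonzero_seq finF F0.
exists (x n) => [|_ [f /Fn fn <-]]; first exact: x0.
by exists n => //; exists f.
Qed.

End Layers.

Section Comparison.
Variables (d : nat) (m o : 'rV[int]_d -> 'rV[int]_d -> 'rV[int]_d).
Hypotheses (d_gt0 : (0 < d)%N) (hm : proper_mul m) (ho : proper_mul o).
Local Notation S := (@nonzero_vecs d).

Definition transition (p b : 'rV[int]_d) : 'M[rat]_d :=
  lmul m p *m invmx (lmul o b).

Lemma transitionE p b x y :
  b <> 0 -> o b y = m p x -> y^Q = x^Q *m transition p b.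
Proof.
move=> b0 eq_om; rewrite mulmxA -(mul_tableE hm) -eq_om (mul_tableE ho).
by rewrite mulmxK // mul_table_unit.
Qed.

Lemma transition_unit p b : p <> 0 -> b <> 0 -> transition p b \in unitmx.
Proof.
by move=> p0 b0; rewrite unitmx_mul unitmx_inv !mul_table_unit.
Qed.

Lemma transition_eq_mem p q b c : q <> 0 -> b <> 0 ->
  transition p b = transition q c ->
  (invmx (lmul o c) *m lmul o b \in mul_table m)%MS.
Proof.
move=> q0 b0 eq_t; have divm := mul_table_division hm.
have b_unit := mul_table_unit ho b0.
have q_unit := mul_table_unit hm q0.
suff -> : invmx (lmul o c) *m lmul o b = invmx (lmul m q) *m lmul m p.
  apply: (mem_division_tableM divm); last exact: mem_lmul_mx.
  exact: mem_division_tableV (mem_lmul_mx _ _).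
apply: (can_inj (mulKmx q_unit)); rewrite mulKVmx // mulmxA.
by rewrite -[lmul m q *m _]eq_t mulmxKV.
Qed.

Lemma separating_layers : exists2 x : nat -> 'rV[int]_d, forall n, x n <> 0 &
  forall k n b c y, b \in nonzero_seq d k -> c \in nonzero_seq d n ->
    layer m x k (o b y) -> layer m x n (o c y) ->
    (invmx (lmul o c) *m lmul o b \in mul_table m)%MS.
Proof.
pose M n := [seq transition p b | p <- nonzero_seq d n, b <- nonzero_seq d n].
have M_mono : {homo M : k n / (k <= n)%N >-> {subset k <= n}}.
  move=> n n' /nonzero_seq_mono sub _ /allpairsP[[p b] [/sub np /sub nb ->]].
  exact: allpairs_f.
have M_neq0 n : 0 \notin M n.
  apply/negP => /allpairsP[[p b] [/= np nb t0]].
  have [p0 b0] := (nonzero_seq_neq0 np, nonzero_seq_neq0 nb).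
  by have := unitmx_neq0 d_gt0 (transition_unit p0 b0); rewrite -t0 eqxx.
have [x x0 x_sep] := separating_sequence d_gt0 M_mono M_neq0.
exists x => // k n b c y kb nc [p kp eq_p] [q nq eq_q].
have [b0 c0] := (nonzero_seq_neq0 kb, nonzero_seq_neq0 nc).
apply: (@transition_eq_mem p q) => //; first exact: nonzero_seq_neq0 nq.
apply: x_sep; [exact: allpairs_f kp kb|exact: allpairs_f nq nc|].
by rewrite -!(transitionE (y := y)).
Qed.

Hypothesis sub_PS : forall A, A `<=` S ->
  piecewise_syndetic S m A -> piecewise_syndetic S o A.

Lemma layer_collisions : exists k (s : 'I_k -> 'rV[int]_d),
  (forall i, s i <> 0) /\ forall f g, f <> 0 -> g <> 0 ->
    exists i j, (invmx (lmul o (o (s j) g)) *m lmul o (o (s i) f)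
      \in mul_table m)%MS.
Proof.
have inf_S := infinite_nonzero_vecs d_gt0.
have [x x0 x_sep] := separating_layers.
have ps_layers := sub_PS (layers_neq0 hm x0) (thick_piecewise_syndetic
  (proper_mulA hm) (proper_mul_neq0 hm) (infinite_setN0 inf_S)
  (thick_layers m x0)).
have [k [s [s0 hit]]] := piecewise_syndetic_bigcup_tail (proper_mulA ho)
  (proper_mul_neq0 ho) inf_S (proper_mulrI ho) (proper_mulIr ho)
  (finite_layer m x) ps_layers.
exists k, s; split=> // f g f0 g0.
have [||N sN] := @finite_sub_nonzero_seq d
    (\bigcup_(i in [set: 'I_k]) [set o (s i) f; o (s i) g]).
- by apply: bigcup_finite => // i _; apply: finite_set2.
- by move=> _ [i _ [->|->]]; apply: (proper_mul_neq0 ho (s0 i)).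
have [||y _ hity] := hit [set f; g] N; first exact: finite_set2.
  by move=> _ [->|->].
have [i [n [leNn layer_f]]] := hity f (or_introl erefl).
have [j [n' [leNn' layer_g]]] := hity g (or_intror erefl).
exists i, j; apply: x_sep layer_f layer_g.
- by apply: nonzero_seq_mono leNn _ (sN _ _); exists i => //; left.
- by apply: nonzero_seq_mono leNn' _ (sN _ _); exists j => //; right.
Qed.

Lemma mul_table_sub : (mul_table o <= mul_table m)%MS.
Proof.
have [divm divo] := (mul_table_division hm, mul_table_division ho).
have [k [s [s0 collide]]] := layer_collisions.
have [g g0] := infinite_setN0 (infinite_nonzero_vecs d_gt0).
pose T (ij : 'I_k * 'I_k) : {linear 'M[rat]_d -> 'M[rat]_d} :=
  mulmx (invmx (lmul o (o (s ij.2) g))) \o mulmxr (lmul o (s ij.1)).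
have TE ij z : z *m (mul_table o *m lin_mx (T ij)) =
    mxvec (T ij (lmul_mx (mul_table o) z)).
  by rewrite mulmxA -mul_vec_lin vec_mxK.
have mem_T f : f <> 0 -> exists ij, (T ij (lmul o f) \in mul_table m)%MS.
  move=> f0; have [i [j mem_ij]] := collide f g f0 g0.
  by exists (i, j); rewrite /= -(mul_tableM ho).
have [x|[i j] sub] := finite_cover_submx (U := mul_table m)
    (G := fun ij => mul_table o *m lin_mx (T ij)).
  have [->|x0] := pselect (x = 0).
    have [ij _] := mem_T g g0; exists ij.
    by rewrite map_mx0 mul0mx sub0mx.
  by have [ij Tx] := mem_T x x0; exists ij; rewrite TE.
have b_neq0 := proper_mul_neq0 ho (s0 j) g0.
apply: (division_table_sub d_gt0 divm divo (mul_table_unit ho b_neq0)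
  (mul_table_unit ho (s0 i))); rewrite ?mem_lmul_mx // => z.
by rewrite -(TE (i, j)); apply: submx_trans sub; apply: submxMl.
Qed.

Lemma proper_mul_isotopy : exists v w : 'rV[int]_d,
  [/\ v <> 0, w <> 0 & forall x y, m (m x v) y = o (o x w) y].
Proof.
have [v [w [v0 w0 vw]]] := division_table_isotopy d_gt0
  (mul_table_division hm) (mul_table_division ho) mul_table_sub.
have [a a0 [z vwE]] := rVrat_intP (row_mx v w).
have vE : v = a *: (lsubmx z)^Q by rewrite map_lsubmx -linearZ /= -vwE row_mxKl.
have wE : w = a *: (rsubmx z)^Q by rewrite map_rsubmx -linearZ /= -vwE row_mxKr.
exists (lsubmx z), (rsubmx z); split=> [z0|z0|x y].
- by move: v0; rewrite vE z0 map_mx0 scaler0 eqxx.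
- by move: w0; rewrite wE z0 map_mx0 scaler0 eqxx.
apply: rVint_ratI; rewrite (mul_tableE hm) (mul_tableE ho).
rewrite !mul_tableM //; congr (_ *m _); apply: (scalerI a0).
by rewrite !scalemxAl -!linearZ -vE -wE vw.
Qed.

End Comparison.

Theorem theoremA (d : nat) (hd : (0 < d)%N)
    (m o : 'rV[int]_d -> 'rV[int]_d -> 'rV[int]_d)
    (hm : proper_mul m) (ho : proper_mul o) :
  PSstar (@nonzero_vecs d) m = PSstar (@nonzero_vecs d) o <->
  exists v w : 'rV[int]_d, [/\ nonzero_vecs v, nonzero_vecs w &
    forall x y : 'rV[int]_d, nonzero_vecs x -> nonzero_vecs y ->
      m (m x v) y = o (o x w) y].
Proof.
rewrite PSstar_eqP; split=> [eqPS|[v [w [v0 w0 vw]]] A _].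
  have [v [w [v0 w0 vw]]] := proper_mul_isotopy hd hm ho
    (fun A A0 => (eqPS A A0).1).
  by exists v, w; split=> // x y _ _; apply: vw.
have [mA m_neq0] := (proper_mulA hm, proper_mul_neq0 hm).
have [oA o_neq0] := (proper_mulA ho, proper_mul_neq0 ho).
split; first exact: (piecewise_syndetic_isotopic mA m_neq0 oA o_neq0 v0 w0 vw).
apply: (piecewise_syndetic_isotopic oA o_neq0 mA m_neq0 w0 v0) => x y x0 y0.
by rewrite vw.
Qed.
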